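(* Let $\beta>0$, let $n\ge 1$, and let $x_1(t),\dots,x_n(t)\in\mathbb{S}^1\subset\mathbb{R}^2$ be a solution of the causal self-attention dynamics with $Q=K=V=I_2$, \[ \dot{x}_{k}(t) = \mathbf{P}_{x_{k}(t)}\Big(\frac{1}{Z_{k}(t)} \sum_{j=1}^k e^{\beta \langle x_{k}(t), x_{j}(t)\rangle} x_{j}(t)\Big),\qquad Z_{k}(t) = \sum_{j=1}^k e^{\beta \langle x_{k}(t), x_{j}(t)\rangle},\qquad k=1,\dots,n . \] Let $\varepsilon,c>0$ and let $s_1<\dots<s_m$ be indices in $\{1,\dots,n\}$ such that $x_{s_1},\dots,x_{s_m}$ are strong R\'enyi centers at time $0$, in the sense that for every $j\in\{1,\dots,m\}$ \[ \min_{i<s_j}|x_{s_j}(0)-x_i(0)|>c(1+2\varepsilon)\beta^{-1/2} \] (the condition being void if $s_j=1$). Assume that \[ c>\beta^{1/2}\arccos\Big(\frac{-1+\sqrt{4\beta^2+1}}{2\beta}\Big). \] Then for every $j\in\{1,\dots,m\}$ and every time $T_j\ge 0$ such that \[ T_j\, s_j\, h(c\beta^{-1/2})<\varepsilon c\beta^{-1/2},\qquad\text{where } h(x)=e^{\beta(\cos x-1)}\sin x, \] one has \[ \max_{t\in[0,T_j]}|x_{s_j}(t)-x_{s_j}(0)|<\varepsilon c\beta^{-1/2}. \]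
   Context: $\mathbb{S}^1$ is the unit circle in $\mathbb{R}^2$, $|\cdot|$ is the Euclidean norm, $\langle\cdot,\cdot\rangle$ the Euclidean inner product, and $\mathbf{P}_x y = y-\frac{\langle x,y\rangle x}{|x|^2}$. In polar coordinates $x_k=(\cos\varphi_k,\sin\varphi_k)^\top$ the system reads $\dot\varphi_k=\frac{1}{Z_k}\sum_{j=1}^{k-1}h(\varphi_j-\varphi_k)$ with $Z_k=\sum_{j=1}^k e^{\beta(\cos(\varphi_k-\varphi_j)-1)}$. *)

(* Defs.v *)
From HB Require Import structures.
From mathcomp Require Import all_boot all_order all_algebra.
From mathcomp Require Import all_classical all_reals all_analysis.

Set Implicit Arguments.
Unset Strict Implicit.
Unset Printing Implicit Defensive.

Import Order.TTheory GRing.Theory Num.Theory.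
Import numFieldNormedType.Exports.

Local Open Scope classical_set_scope.
Local Open Scope ring_scope.

Definition dotv (R : realType) (d : nat) (u v : 'cV[R]_d) : R :=
  \sum_(i < d) u i 0 * v i 0.

(* The library norm `|u| on matrices is the maximum norm, hence this one. *)
Definition enorm (R : realType) (d : nat) (u : 'cV[R]_d) : R :=
  Num.sqrt (dotv u u).

Definition proj_tangent (R : realType) (d : nat) (x y : 'cV[R]_d) : 'cV[R]_d :=
  y - (dotv x y / enorm x ^+ 2) *: x.

(* Derivative of f at t relative to A: s tends to t with s in A, s != t.
   At an interior point of A it is the ordinary derivative; for A = [0, +oo[
   it is the right derivative at 0. *)
Definition has_derivative_within (R : realType) (d : nat) (A : set R)
    (f : R -> 'cV[R]_d) (t : R) (l : 'cV[R]_d) : Prop :=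
  (s - t)^-1 *: (f s - f t) @[s --> within A (dnbhs t)] --> l.

(* Tokens are numbered from 0: k : 'I_n stands for the token of rank k + 1,
   and j <= k ranges over the tokens of rank 1, ..., k + 1. *)
Definition partition_fun (R : realType) (d n : nat) (beta : R)
    (y : 'I_n -> 'cV[R]_d) (k : 'I_n) : R :=
  \sum_(j < n | (j <= k)%N) expR (beta * dotv (y k) (y j)).

Definition causal_field (R : realType) (d n : nat) (beta : R)
    (y : 'I_n -> 'cV[R]_d) (k : 'I_n) : 'cV[R]_d :=
  proj_tangent (y k)
    ((partition_fun beta y k)^-1 *:
       \sum_(j < n | (j <= k)%N) expR (beta * dotv (y k) (y j)) *: y j).

Definition causal_attention_solution (R : realType) (d n : nat) (beta : R)
    (x : 'I_n -> R -> 'cV[R]_d) : Prop :=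
  forall (k : 'I_n) (t : R), 0 <= t ->
    enorm (x k t) = 1 /\
    has_derivative_within `[0, +oo[ (x k) t
      (causal_field beta (fun j => x j t) k).

Definition strong_renyi_center (R : realType) (d n : nat) (beta c eps : R)
    (y : 'I_n -> 'cV[R]_d) (k : 'I_n) : Prop :=
  forall i : 'I_n, (i < k)%N ->
    c * (1 + 2 * eps) * (Num.sqrt beta)^-1 < enorm (y k - y i).

Definition h (R : realType) (beta x : R) : R :=
  expR (beta * (cos x - 1)) * sin x.

Definition is_max (R : realType) (A : set R) (M : R) : Prop :=
  A M /\ ubound A M.

(* Main.v *)
(* Let p be the initial position of the centre x_k and a = c / sqrt beta.
   Everything is measured in chords, without lifting to angles.  A particle y at
   distance at least a from x pulls x with speed at most h(a), because h
   decreases beyond the arccos threshold.  Consider a predecessor x_i at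
   distance r from p, with no earlier particle nearer to p: the particles within
   distance a of x_i lie on the far side of x_i from p and pull it away, the
   others pull it towards p at speed at most h(a) each.  Hence the empty disc
   around p shrinks at most at speed v = (k + 1) h(a), from radius (1 + 2 eps) a
   to more than (1 + eps) a at time T.  As long as x_k is within eps a of p, all
   its predecessors are at distance at least a, so x_k itself moves at speed less
   than v and cannot cover the distance eps a before T. *)

Require Import Defs.
From HB Require Import structures.
From mathcomp Require Import all_boot all_order all_algebra.
From mathcomp Require Import all_classical all_reals all_analysis.
From mathcomp Require Import ring lra.

Set Implicit Arguments.
Unset Strict Implicit.
Unset Printing Implicit Defensive.

Import Order.TTheory GRing.Theory Num.Theory.
Import numFieldNormedType.Exports.

Local Open Scope classical_set_scope.
Local Open Scope ring_scope.

(** * Monotonicity of [h], expressed through cosines *)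

Lemma sin_le_id (R : realType) (x : R) : 0 <= x -> sin x <= x.
Proof.
rewrite le_eqVlt => /predU1P[<-|x0]; first by rewrite sin0.
have [y _ ] := @MVT _ (@sin R) cos 0 x x0 (fun y _ => is_derive_sin y)
  (continuous_subspaceT (@continuous_sin R)).
rewrite sin0 !subr0 => ->; rewrite ler_piMl ?cos_le1 //; exact: ltW.
Qed.

(** Half-angle formula and [sin (x / 2) <= x / 2]; from [x = 2] on, the left side is at most -1.
    This converts a chord of length at least [a] into an angle of at least [a]. *)
Lemma cos_ge_1Bsqr2 (R : realType) (x : R) : 0 <= x -> 1 - x ^+ 2 / 2 <= cos x.
Proof.
move=> x0; have h0 : 0 <= x / 2 by lra.
have := sin_le_id h0; have := cosD (x / 2) (x / 2); have := cos2Dsin2 (x / 2).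
rewrite -splitr => e1 e2 h1; have [x2|x2] := leP 2 x.
  by have := cos_geN1 x; nra.
have : 0 <= sin (x / 2).
  by apply: sin_ge0_pi; rewrite h0 /=; have := pi_ge2 R; lra.
by nra.
Qed.

(** The conclusion is the sign condition [h' <= 0] at [a]. The fraction [C] is the positive root of
    [beta X^2 + X = beta], and [cos a <= C]. *)
Lemma acos_threshold_le (R : realType) (beta a : R) : 0 < beta -> a <= pi ->
  acos ((- 1 + Num.sqrt (4 * beta ^+ 2 + 1)) / (2 * beta)) <= a ->
  cos a <= beta * (1 - cos a ^+ 2).
Proof.
move=> b0 api; set q := Num.sqrt _; set C := _ / _ => Ca.
have q0 : 0 <= q by exact: sqrtr_ge0.
have q2 : q ^+ 2 = 4 * beta ^+ 2 + 1 by rewrite sqr_sqrtr //; nra.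
have q1 : 1 < q by nra.
have qb : q < 2 * beta + 1 by nra.
have Cb : C * (2 * beta) = q - 1 by rewrite /C divfK; lra.
have C0 : 0 < C by nra.
have C1 : C < 1 by nra.
have CI : -1 <= C <= 1 by apply/andP; split; lra.
have cC : cos a <= C.
  rewrite -[leRHS]acosK ?in_itv //= leNgt ltr_cos ?in_itv /= -?leNgt //.
    by rewrite (le_trans _ Ca) ?acos_ge0.
  by rewrite acos_ge0 // acos_lepi.
have Cq : beta * C ^+ 2 + C = beta.
  apply: (@mulIf _ (4 * beta)); first by lra.
  have -> : (beta * C ^+ 2 + C) * (4 * beta)
    = (C * (2 * beta)) ^+ 2 + 2 * (C * (2 * beta)) by ring.
  by rewrite Cb; nra.
have := cos_le1 a; have := cos_geN1 a.
move=> cN1 c1; have [c0|c0] := leP (cos a) 0.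
  by rewrite (le_trans c0) // mulr_ge0 ?(ltW b0) //; nra.
have : cos a ^+ 2 <= C ^+ 2 by nra.
by move=> /(ler_wpM2l (ltW b0)); lra.
Qed.

(** With [C] and [D] as cosines, [h] is larger at the smaller angle. Put [y = beta (D - C)]: after
    squaring, the exponential factor is at least [1 + 2 y], and [D^2 - C^2 <= 2 D (D - C) <= 2 y (1
    - D^2)]. *)
Lemma expR_mul_sqrt_le (R : realType) (beta C D : R) : 0 < beta ->
  -1 <= C -> C <= D -> D <= 1 -> D <= beta * (1 - D ^+ 2) ->
  expR (beta * (C - 1)) * Num.sqrt (1 - C ^+ 2)
    <= expR (beta * (D - 1)) * Num.sqrt (1 - D ^+ 2).
Proof.
move=> b0 C1 CD D1 Db.
have -> : beta * (D - 1) = beta * (C - 1) + beta * (D - C) by ring.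
rewrite expRD -mulrA ler_pM2l ?expR_gt0 //.
have e1 := expR_ge1Dx (beta * (D - C)).
have e0 := expR_gt0 (beta * (D - C)).
rewrite -ler_sqr ?nnegrE ?mulr_ge0 ?sqrtr_ge0 ?expR_ge0 //.
rewrite exprMn !sqr_sqrtr; [|nra|nra].
set E := expR _ in e1 e0 *.
have bDC : 0 <= beta * (D - C) by nra.
have : (1 + 2 * (beta * (D - C))) <= E ^+ 2 by nra.
have D2 : 0 <= 1 - D ^+ 2 by nra.
have h1 : 1 - C ^+ 2 <= (1 + 2 * (beta * (D - C))) * (1 - D ^+ 2) by nra.
move=> h2; apply: (le_trans h1); exact: ler_wpM2r.
Qed.

(** * Euclidean inner product and norm *)

Section DotProduct.
Variables (R : realType) (d : nat).
Implicit Types u v w : 'cV[R]_d.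

Lemma dotvC u v : dotv u v = dotv v u.
Proof. by apply: eq_bigr => i _; rewrite mulrC. Qed.

Lemma dotvDl u v w : dotv (u + v) w = dotv u w + dotv v w.
Proof. by rewrite -big_split; apply: eq_bigr => i _; rewrite mxE mulrDl. Qed.

Lemma dotvZl (a : R) u w : dotv (a *: u) w = a * dotv u w.
Proof. by rewrite mulr_sumr; apply: eq_bigr => i _; rewrite mxE mulrA. Qed.

Lemma dotvNl u w : dotv (- u) w = - dotv u w.
Proof. by rewrite -scaleN1r dotvZl mulN1r. Qed.

Lemma dotvBl u v w : dotv (u - v) w = dotv u w - dotv v w.
Proof. by rewrite dotvDl dotvNl. Qed.

Lemma dotvNr u w : dotv u (- w) = - dotv u w.
Proof. by rewrite dotvC dotvNl dotvC. Qed.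

Lemma dotvBr u v w : dotv w (u - v) = dotv w u - dotv w v.
Proof. by rewrite dotvC dotvBl !(dotvC w). Qed.

Lemma dotv_suml (I : Type) (r : seq I) (P : pred I) (F : I -> 'cV[R]_d) w :
  dotv (\sum_(i <- r | P i) F i) w = \sum_(i <- r | P i) dotv (F i) w.
Proof.
elim/big_rec2: _ => [|i a v _ <-]; last by rewrite dotvDl.
by rewrite -(subrr w) dotvBl subrr.
Qed.

Lemma dotv_ge0 u : 0 <= dotv u u.
Proof. by apply: sumr_ge0 => i _; rewrite -expr2 sqr_ge0. Qed.

Lemma enorm_ge0 u : 0 <= enorm u.
Proof. exact: sqrtr_ge0. Qed.

Lemma sqr_enorm u : enorm u ^+ 2 = dotv u u.
Proof. by rewrite sqr_sqrtr ?dotv_ge0. Qed.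

Lemma sqr_enormB_unit u v : enorm u = 1 -> enorm v = 1 ->
  enorm (u - v) ^+ 2 = 2 - 2 * dotv u v.
Proof.
move=> u1 v1; rewrite sqr_enorm !dotvBl !dotvBr -!sqr_enorm u1 v1 (dotvC v u).
by ring.
Qed.

Lemma enormBC u v : enorm (u - v) = enorm (v - u).
Proof. by rewrite /enorm -opprB dotvNl dotvNr opprK. Qed.

End DotProduct.

(** * Unit vectors in the plane *)

Section Plane.
Variable R : realType.
Implicit Types x y p : 'cV[R]_2.

Lemma dotv2E x y : dotv x y = x 0 0 * y 0 0 + x 1 0 * y 1 0.
Proof.
rewrite /dotv !big_ord_recl big_ord0 addr0.
by have -> : lift ord0 ord0 = 1 :> 'I_2 by exact: val_inj.
Qed.

(** Squaring reduces the claim to Cauchy-Schwarz, which follows from Lagrange's identity. *)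
Lemma enorm_triangle2 x y : enorm (x + y) <= enorm x + enorm y.
Proof.
rewrite -ler_sqr ?nnegrE ?addr_ge0 ?enorm_ge0 // sqrrD !sqr_enorm.
have -> : dotv (x + y) (x + y) = dotv x x + dotv x y *+ 2 + dotv y y.
  by rewrite !dotv2E !mxE; ring.
rewrite lerD2r lerD2l lerMn2r /=.
rewrite (le_trans (ler_norm _)) // -ler_sqr ?nnegrE ?mulr_ge0 ?enorm_ge0 //.
rewrite real_normK ?num_real // exprMn !sqr_enorm -subr_ge0 !dotv2E.
set a := x 0 0; set b := x 1 0; set c := y 0 0; set e := y 1 0.
have -> : (a * a + b * b) * (c * c + e * e) - (a * c + b * e) ^+ 2
  = (a * e - b * c) ^+ 2 by ring.
exact: sqr_ge0.
Qed.

Lemma dotv_unit_itv x y : enorm x = 1 -> enorm y = 1 -> -1 <= dotv x y <= 1.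
Proof.
move=> x1 y1; have := sqr_enorm (x + y); have := sqr_enorm (x - y).
have := sqr_ge0 (enorm (x + y)); have := sqr_ge0 (enorm (x - y)).
have := sqr_enorm x; have := sqr_enorm y; rewrite x1 y1.
have -> : dotv (x + y) (x + y) = dotv x x + 2 * dotv x y + dotv y y.
  by rewrite !dotv2E !mxE; ring.
have -> : dotv (x - y) (x - y) = dotv x x - 2 * dotv x y + dotv y y.
  by rewrite !dotv2E !mxE; ring.
by move=> *; apply/andP; split; lra.
Qed.

(* Vanishing of the Gram determinant of three plane vectors. *)
Lemma gram_unit2 x y p : enorm x = 1 -> enorm y = 1 -> enorm p = 1 ->
  (dotv y p - dotv x y * dotv x p) ^+ 2
    = (1 - dotv x y ^+ 2) * (1 - dotv x p ^+ 2).
Proof.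
move=> x1 y1 p1; have := sqr_enorm x; have := sqr_enorm y; have := sqr_enorm p.
rewrite x1 y1 p1 expr1n !dotv2E.
set a := x 0 0; set b := x 1 0; set c := y 0 0; set e := y 1 0.
set f := p 0 0; set g := p 1 0 => hp hy hx.
have -> : c * f + e * g - (a * c + b * e) * (a * f + b * g)
   = (a * e - b * c) * (a * g - b * f).
  by rewrite -[c * f + _]mul1r hx; ring.
rewrite exprMn; congr (_ * _).
  transitivity ((a * a + b * b) * (c * c + e * e) - (a * c + b * e) ^+ 2).
    by ring.
  by rewrite -hx -hy mulr1.
transitivity ((a * a + b * b) * (f * f + g * g) - (a * f + b * g) ^+ 2).
  by ring.
by rewrite -hx -hp mulr1.
Qed.

(** The left side is the component along [p] of the projection of [y] on the tangent at [x]. By the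
    Gram identity it remains to use [1 - u^2 <= 2 (1 - u) = |x - p|^2] with [u = <x, p>]. *)
Lemma gram_unit2_le x y p : enorm x = 1 -> enorm y = 1 -> enorm p = 1 ->
  `|dotv y p - dotv x y * dotv x p|
    <= Num.sqrt (1 - dotv x y ^+ 2) * enorm (x - p).
Proof.
move=> x1 y1 p1; have /andP[w1 w2] := dotv_unit_itv x1 y1.
have /andP[u1 u2] := dotv_unit_itv x1 p1.
rewrite -ler_sqr ?nnegrE ?mulr_ge0 ?sqrtr_ge0 //.
rewrite real_normK ?num_real // gram_unit2 // exprMn sqr_sqrtr; last by nra.
rewrite sqr_enormB_unit //.
by apply: ler_wpM2l; nra.
Qed.

(* If [y] is nearer to [x] than [p] is, but not nearer to [p] than [x] is,
   then [x] separates [y] from [p], so moving towards [y] leaves [p]. *)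
Lemma dotv_tangent_le0 x y p : enorm x = 1 -> enorm y = 1 -> enorm p = 1 ->
  dotv y p <= dotv x p -> dotv x p < dotv x y ->
  dotv y p - dotv x y * dotv x p <= 0.
Proof.
move=> x1 y1 p1; have := gram_unit2 x1 y1 p1.
have /andP[w1 w2] := dotv_unit_itv x1 y1; have /andP[u1 u2] := dotv_unit_itv x1 p1.
move: (dotv y p) (dotv x y) (dotv x p) w1 w2 u1 u2 => z w u w1 w2 u1 u2 e zu uw.
rewrite leNgt; apply/negP => T0.
have w_lt1 : w < 1 by rewrite lt_neqAle w2 andbT; apply/eqP => w1E; subst w; nra.
(* Squaring this, inserting the Gram identity and dividing by [1 - w] gives [1 + w <= 2 u^2],
   impossible for [0 < u < w <= 1]. *)
have h : z - w * u <= u * (1 - w) by lra.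
have h2 : (1 - w ^+ 2) * (1 - u ^+ 2) <= (u * (1 - w)) ^+ 2 by rewrite -e; nra.
have u0 : 0 < u by nra.
have h3 : (1 - w) * ((1 + w) * (1 - u ^+ 2)) <= (1 - w) * (u ^+ 2 * (1 - w)).
  by apply: le_trans (le_trans h2 _); rewrite le_eqVlt; apply/predU1P; left; ring.
rewrite ler_pM2l in h3; last by lra.
by nra.
Qed.

End Plane.

(** * Trajectories tested against a fixed vector *)

Lemma continuous_dotv (R : realType) (d : nat) (e : 'cV[R]_d) :
  continuous (fun u => dotv u e).
Proof.
move=> u; apply: (@cvg_big _ _ _ _ _ _ _ (nbhs u)) => [|i _].
  exact: add_continuous.
apply: (@cvgM _ _ (nbhs u)); last exact: cvg_cst.
exact: coord_continuous.
Qed.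

Section Trajectory.
Variables (R : realType) (d : nat) (f : R -> 'cV[R]_d) (t : R) (l : 'cV[R]_d).
Variable e : 'cV[R]_d.
Hypothesis fl : has_derivative_within `[0, +oo[ f t l.

Lemma dotv_slope_cvg :
  (s - t)^-1 * (dotv (f s) e - dotv (f t) e)
    @[s --> within `[0, +oo[ t^'] --> dotv l e.
Proof.
have -> : (fun s => (s - t)^-1 * (dotv (f s) e - dotv (f t) e))
    = (fun u => dotv u e) \o (fun s => (s - t)^-1 *: (f s - f t)).
  by apply/funext => s /=; rewrite dotvZl dotvBl.
exact: cvg_comp fl (@continuous_dotv _ _ e l).
Qed.

Lemma dotv_within_cvg :
  dotv (f s) e @[s --> within `[0, +oo[ (nbhs t)] --> dotv (f t) e.
Proof.
have slopeP : (s - t) * ((s - t)^-1 * (dotv (f s) e - dotv (f t) e))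
    @[s --> within `[0, +oo[ t^'] --> (t - t) * dotv l e.
  apply: cvgM dotv_slope_cvg; apply: cvgB (cvg_cst _).
  by apply: cvg_within_filter; apply: cvg_within_filter; exact: cvg_id.
rewrite subrr mul0r in slopeP.
apply/cvgrPdist_lt => r r0; move/cvgrPdist_lt: slopeP => /(_ r r0).
rewrite !near_withinE => near_t; apply: filterS near_t => s near_s s0.
have [->|st] := eqVneq s t; first by rewrite subrr normr0.
have := near_s st s0.
by rewrite mulrA divff ?subr_eq0 // mul1r sub0r normrN distrC.
Qed.

(** The slope, completed by its limit at [t], is a Caratheodory factor. Since [0 < t], the
    restriction to [[0, +oo[] is void near [t]. *)
Lemma is_derive_dotv : 0 < t -> is_derive t 1 (fun s => dotv (f s) e) (dotv l e).
Proof.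
move=> t0; apply/is_derive1_caratheodory.
exists (fun s => if s == t then dotv l e
  else (s - t)^-1 * (dotv (f s) e - dotv (f t) e)); split=> [s||].
- have [->|st] := eqVneq s t; first by rewrite !subrr mulr0.
  by rewrite mulrAC mulVf ?subr_eq0 // mul1r.
- apply/cvgrPdist_lt => r r0; rewrite eqxx.
  move/cvgrPdist_lt: dotv_slope_cvg => /(_ r r0); rewrite !near_withinE => near_t.
  have pos_t : \forall s \near t, 0 < s by exact: lt_nbhsr.
  near=> s; have [_|st] := eqVneq s t; first by rewrite subrr normr0.
  have s0 : 0 < s by near: s.
  have : s != t -> `[0, +oo[%classic s ->
      `|dotv l e - (s - t)^-1 * (dotv (f s) e - dotv (f t) e)| < r.
    by near: s.
  by apply=> //=; rewrite in_itv /= andbT ltW.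
- by rewrite eqxx.
Unshelve. all: by end_near. Qed.

End Trajectory.

(** * First-crossing principle *)

(** At the first time [t0] with [g <= 0], continuity forces [g t0 = 0]; a positive derivative there
    would make [g] negative just before [t0]. *)
Lemma pos_of_upcrossing (R : realType) (g : R -> R) (T : R) :
  {within `[0, T], continuous g} -> 0 < g 0 ->
  (forall t, 0 < t <= T -> g t = 0 -> exists2 g', 0 < g' & is_derive t 1 g g') ->
  forall t, 0 <= t <= T -> 0 < g t.
Proof.
move=> gc g0 cross t1 /andP[t10 t1T]; rewrite ltNge; apply/negP => gt1.
move/subspace_continuousP in gc.
pose A := [set s | 0 <= s <= t1 /\ g s <= 0].
have At1 : A t1 by split; rewrite ?t10 ?lexx.
have Alb : has_lbound A by exists 0 => s [/andP[]].
have Ainf : has_inf A by split=> //; exists t1.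
set t0 := inf A.
have t00 : 0 <= t0 by apply: lb_le_inf; [exists t1|move=> s [/andP[]]].
have t0t1 : t0 <= t1 by exact: ge_inf.
have t0T : `[0, T]%classic t0 by rewrite /= in_itv /= t00 (le_trans t0t1).
have before s : 0 <= s -> s < t0 -> 0 < g s.
  move=> s0 st0; rewrite ltNge; apply/negP => gs.
  have : A s by split=> //; rewrite s0 (le_trans (ltW st0)).
  by move=> /(ge_inf Alb); rewrite leNgt st0.
have gt0_le0 : g t0 <= 0.
  rewrite leNgt; apply/negP => gt0.
  have /cvgrPdist_lt/(_ _ gt0) := gc _ t0T; rewrite near_withinE.
  move=> /nbhs_ballP[r /= r0 ball_r].
  have [s As str] := inf_adherent r0 Ainf.
  have [/andP[s0 st1] gs] := As.
  have t0s : t0 <= s by exact: ge_inf.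
  have : `|g t0 - g s| < g t0.
    apply: ball_r; last by rewrite /= in_itv /= s0 (le_trans st1).
    by rewrite /ball /= ler0_norm ?subr_le0 // opprB ltrBlDl.
  by rewrite ltr_distlC => /andP[]; lra.
have t0_gt0 : 0 < t0.
  by rewrite lt_neqAle t00 andbT; apply/eqP => t0E; move: gt0_le0; rewrite -t0E; lra.
have gt0E : g t0 = 0.
  apply/eqP; rewrite eq_le gt0_le0 /= leNgt; apply/negP => gt0.
  have gt0N : 0 < - g t0 by lra.
  have /cvgrPdist_lt/(_ _ gt0N) := gc _ t0T; rewrite near_withinE.
  move=> /nbhs_ballP[r /= r0 ball_r].
  (* A nonnegative time just before [t0], inside the ball of radius [r]. *)
  pose s := Num.max (t0 / 2) (t0 - r / 2).
  have st0 : s < t0 by rewrite gt_max; apply/andP; split; lra.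
  have s0 : 0 <= s by rewrite le_max; apply/orP; left; lra.
  have rs : t0 - r / 2 <= s by rewrite le_max lexx orbT.
  have : `|g t0 - g s| < - g t0.
    apply: ball_r; last by rewrite /= in_itv /= s0 (le_trans (ltW st0)) ?(le_trans t0t1).
    by rewrite /ball /= ger0_norm; lra.
  by rewrite ltr_distlC => /andP[]; have := before _ s0 st0; lra.
have t0_itv : 0 < t0 <= T by rewrite t0_gt0 (le_trans t0t1).
have [g' g'0 /is_derive1_caratheodory[q [gq qc qE]]] := cross _ t0_itv gt0E.
rewrite -qE in g'0; move/cvgrPdist_lt: qc => /(_ _ g'0).
move=> /nbhs_ballP[r /= r0 ball_r].
pose s := Num.max (t0 / 2) (t0 - r / 2).
have st0 : s < t0 by rewrite gt_max; apply/andP; split; lra.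
have s0 : 0 <= s by rewrite le_max; apply/orP; left; lra.
have rs : t0 - r / 2 <= s by rewrite le_max lexx orbT.
have : `|q t0 - q s| < q t0.
  by apply: ball_r; rewrite /ball /= ger0_norm; lra.
(* Here [q s > 0], so [g s = q s * (s - t0)] is negative, against [before]. *)
rewrite ltr_distlC => /andP[q1 q2]; have := before _ s0 st0.
have := gq s; rewrite gt0E subr0 => ->.
by nra.
Qed.

(** * Bounds on the attraction *)

(** The self-term [j = k] has no tangential part, which leaves [k] summands, but it gives
    [Z >= exp beta]. Dividing by [Z] thus turns the weights [exp (beta w)] into at most
    [exp (beta (w - 1))] in the bound. *)
Lemma dotv_causal_field_le (R : realType) (d n : nat) (beta B : R)
    (y : 'I_n -> 'cV[R]_d) (k : 'I_n) (e : 'cV[R]_d) :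
  enorm (y k) = 1 -> 0 <= B ->
  (forall j : 'I_n, (j < k)%N -> expR (beta * (dotv (y k) (y j) - 1))
     * (dotv (y j) e - dotv (y k) (y j) * dotv (y k) e) <= B) ->
  dotv (causal_field beta y k) e <= k%:R * B.
Proof.
move=> yk B0 yB; rewrite /causal_field /proj_tangent yk expr1n divr1.
set Z := partition_fun beta y k.
have eZ : expR beta <= Z.
  rewrite /Z /partition_fun (bigD1 k) //= -sqr_enorm yk expr1n mulr1 lerDl.
  by apply: sumr_ge0 => j _; exact: expR_ge0.
have Z0 : 0 < Z by exact: lt_le_trans (expR_gt0 _) eZ.
rewrite dotvBl !dotvZl (dotvC (y k)) dotvZl !dotv_suml -mulrA -mulrBr.
rewrite mulr_suml -sumrB ler_pdivrMl //.
have -> : k%:R * B = \sum_(j < n | (j < k)%N) B.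
  by rewrite -(big_ord_widen n (fun=> B)) ?sumr_const ?card_ord ?mulr_natl // ltnW.
rewrite (bigD1 k) //= dotvZl [X in X + _](_ : _ = 0); last first.
  by rewrite dotvZl -sqr_enorm yk expr1n !mulr1 subrr.
rewrite add0r mulr_sumr.
rewrite (eq_bigl (fun j : 'I_n => (j < k)%N)); last first.
  by move=> j; rewrite ltn_neqAle andbC.
apply: ler_sum => j jk; rewrite !dotvZl -mulrA -mulrBr (dotvC (y j) (y k)).
have -> : beta * dotv (y k) (y j) = beta + beta * (dotv (y k) (y j) - 1).
  by ring.
rewrite expRD -mulrA (@le_trans _ _ (expR beta * B)) //.
  by rewrite ler_pM2l ?expR_gt0 //; exact: yB.
exact: ler_wpM2r.
Qed.

(** A chord of length at least [a] has cosine at most [1 - a^2 / 2 <= cos a], so the monotonicity of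
    [h] applies. *)
Lemma attraction_le_h (R : realType) (beta a : R) (x y : 'cV[R]_2) :
  0 < beta -> 0 <= a -> a <= pi ->
  acos ((- 1 + Num.sqrt (4 * beta ^+ 2 + 1)) / (2 * beta)) <= a ->
  enorm x = 1 -> enorm y = 1 -> a <= enorm (x - y) ->
  expR (beta * (dotv x y - 1)) * Num.sqrt (1 - dotv x y ^+ 2) <= h beta a.
Proof.
move=> b0 a0 api thr x1 y1 axy.
have sina : sin a = Num.sqrt (1 - cos a ^+ 2).
  by rewrite -sin2cos2 sqrtr_sqr ger0_norm // sin_ge0_pi // a0.
have /andP[w1 w2] := dotv_unit_itv x1 y1.
rewrite /h sina; apply: expR_mul_sqrt_le (cos_le1 a) (acos_threshold_le _ _ _) => //.
have : a ^+ 2 <= enorm (x - y) ^+ 2 by rewrite ler_sqr ?nnegrE ?enorm_ge0.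
by rewrite sqr_enormB_unit //; have := cos_ge_1Bsqr2 a0; lra.
Qed.

(** * Moving barriers around an initial position *)

(** For [u = <x, p>] with unit vectors, this function is the squared distance to [p] minus the
    square of an affine radius; squares avoid differentiating the norm. *)
Lemma is_derive_gap (R : realType) (u : R -> R) (t u' alpha mu : R) :
  is_derive t 1 u u' ->
  is_derive t 1 (fun s => 2 - 2 * u s - (alpha + mu * s) ^+ 2)
    (- (2 * u') - 2 * mu * (alpha + mu * t)).
Proof.
move=> /is_derive1_caratheodory[q [uq qc <-]]; apply/is_derive1_caratheodory.
exists (fun s => - (2 * q s) - mu * (2 * alpha + mu * (s + t))); split=> [s||].
- have us : u s = u t + q s * (s - t) by rewrite -uq; ring.
  by rewrite us; ring.
- apply: cvgB.
    by apply: cvgN; apply: cvgM => //; exact: cvg_cst.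
  apply: cvgM; first exact: cvg_cst.
  apply: cvgD; first exact: cvg_cst.
  apply: cvgM; first exact: cvg_cst.
  by apply: cvgD; [exact: cvg_id|exact: cvg_cst].
- by ring.
Qed.

Lemma continuous_gap (R : realType) (A : set R) (u : R -> R) (alpha mu : R) :
  {within A, continuous u} ->
  {within A, continuous (fun s => 2 - 2 * u s - (alpha + mu * s) ^+ 2)}.
Proof.
move=> uc t; apply: (@cvgB _ _ _ (nbhs t)).
  apply: (@cvgB _ _ _ (nbhs t)); first exact: cvg_cst.
  by apply: (@cvgM _ _ (nbhs t)); [exact: cvg_cst|exact: uc].
move: t; apply: continuous_subspaceT => s.
by apply: cvgM; (apply: cvgD; first exact: cvg_cst);
  apply: cvgM; [exact: cvg_cst|exact: cvg_id|exact: cvg_cst|exact: cvg_id].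
Qed.

Section Barriers.
Variables (R : realType) (n : nat) (beta : R) (x : 'I_n -> R -> 'cV[R]_2).
Hypothesis x_sol : causal_attention_solution beta x.

Lemma within_continuous_dotv (k : 'I_n) (e : 'cV[R]_2) (T : R) :
  {within `[0, T], continuous (fun t => dotv (x k t) e)}.
Proof.
apply: (@continuous_subspaceW _ _ `[0, T]%classic `[0, +oo[%classic).
  by move=> t; rewrite /= !in_itv /= => /andP[->].
apply/subspace_continuousP => t; rewrite /= in_itv /= andbT => t0.
exact: dotv_within_cvg (x_sol k t0).2.
Qed.

Lemma predecessors_stay_away (a r v T : R) (p : 'cV[R]_2) (k : nat) :
  0 <= T -> 0 < beta -> 0 < a -> a <= pi ->
  acos ((- 1 + Num.sqrt (4 * beta ^+ 2 + 1)) / (2 * beta)) <= a ->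
  enorm p = 1 -> 0 < v -> 0 <= h beta a -> k%:R * h beta a < v ->
  a <= r - v * T ->
  (forall i : 'I_n, (i < k)%N -> r < enorm (x i 0 - p)) ->
  forall i : 'I_n, (i < k)%N ->
  forall t, 0 <= t <= T -> r - v * t < enorm (x i t - p).
Proof.
move=> T0 b0 a0 api thr p1 v0 h0 hv ar xp [i lt_in] /=.
(* Strong induction: all earlier particles are already known to stay outside the shrinking disc on
   all of [[0, T]]. *)
elim/ltn_ind: i => i IH in lt_in * => ik.
set i' := Ordinal lt_in; pose u t := dotv (x i' t) p.
have gapE t : 0 <= t -> enorm (x i' t - p) ^+ 2 = 2 - 2 * u t.
  by move=> t0; rewrite sqr_enormB_unit //; exact: (x_sol i' t0).1.
have rt t : 0 <= t <= T -> a <= r - v * t by case/andP => t0 tT; nra.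
pose g s := 2 - 2 * u s - (r + - v * s) ^+ 2.
suff g_gt0 t : 0 <= t <= T -> 0 < g t.
  move=> t tT; have := g_gt0 _ tT; have := rt _ tT; case/andP: tT => t0 _ art.
  rewrite /g -gapE // subr_gt0 mulNr ltr_sqr ?nnegrE ?enorm_ge0 //.
  exact: le_trans (ltW a0) art.
move: t; apply: pos_of_upcrossing.
- by apply: continuous_gap; exact: within_continuous_dotv.
- rewrite /g -gapE // mulr0 addr0 subr_gt0.
  have r0 : 0 <= r by nra.
  by rewrite ltr_sqr ?nnegrE ?enorm_ge0 //; exact: xp.
- move=> t /andP[t0 tT] gt0.
  have t00 := ltW t0.
  have tI : 0 <= t <= T by rewrite t00.
  have art := rt _ tI.
  set rho := r - v * t in art.
  have rho0 : 0 < rho by exact: lt_le_trans art.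
  have xi1 := (x_sol i' t00).1.
  have dist_i : enorm (x i' t - p) = rho.
    apply/eqP; rewrite -(@eqrXn2 _ 2) ?enorm_ge0 ?(ltW rho0) // gapE // /rho.
    by apply/eqP; move: gt0; rewrite /g; lra.
  eexists; last first.
    by apply: is_derive_gap; exact: is_derive_dotv (x_sol i' t00).2 t0.
  (* When [x_i] touches the circle of radius [rho], the gap has derivative [2 (v rho - u')]. *)
  suff : dotv (causal_field beta (fun j => x j t) i') p < v * rho.
    by rewrite /rho; lra.
  apply: (@le_lt_trans _ _ (i%:R * (h beta a * rho))); last first.
    rewrite mulrA ltr_pM2r //; apply: le_lt_trans hv.
    by rewrite ler_wpM2r // ler_nat ltnW.
  apply: dotv_causal_field_le => //; first by rewrite mulr_ge0 // ltW.
  move=> [j lt_jn] /= ji; set j' := Ordinal lt_jn.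
  have xj1 := (x_sol j' t00).1.
  have dist_j : rho < enorm (x j' t - p) by apply: IH => //; exact: ltn_trans ik.
  have zu : dotv (x j' t) p <= dotv (x i' t) p.
    have : rho ^+ 2 < enorm (x j' t - p) ^+ 2.
      by rewrite ltr_sqr ?nnegrE ?enorm_ge0 ?(ltW rho0).
    by rewrite -dist_i !sqr_enormB_unit //; lra.
  (* A far predecessor pulls by at most [h a * rho]. A near one is closer to [x_i] than [p] is,
     because [a <= rho], and pulls away from [p]. *)
  have [far|near] := leP a (enorm (x i' t - x j' t)).
    have att := attraction_le_h b0 (ltW a0) api thr xi1 xj1 far.
    apply: le_trans (ler_wpM2r (ltW rho0) att).
    rewrite -mulrA ler_pM2l ?expR_gt0 // -dist_i.
    exact: le_trans (ler_norm _) (gram_unit2_le xi1 xj1 p1).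
  apply: (@le_trans _ _ 0); last by rewrite mulr_ge0 // ltW.
  rewrite pmulr_rle0 ?expR_gt0 //; apply: dotv_tangent_le0 => //.
  have : enorm (x i' t - x j' t) ^+ 2 < enorm (x i' t - p) ^+ 2.
    by rewrite ltr_sqr ?nnegrE ?enorm_ge0 // dist_i; exact: lt_le_trans art.
  by rewrite !sqr_enormB_unit //; lra.
Qed.

(** The barrier radius [delta + v t] grows at speed [v]. Starting it at [delta > 0] makes the gap
    strictly positive at time 0. The bound [slow] is needed only when the barrier is touched, where
    the distance is below [rho], so there is no circularity. *)
Lemma center_stays (B delta rho v T : R) (k : 'I_n) :
  0 <= B -> k%:R * B < v -> 0 < delta -> delta + v * T < rho ->
  (forall t, 0 <= t <= T -> enorm (x k t - x k 0) < rho ->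
    forall j : 'I_n, (j < k)%N ->
    expR (beta * (dotv (x k t) (x j t) - 1))
      * Num.sqrt (1 - dotv (x k t) (x j t) ^+ 2) <= B) ->
  forall t, 0 <= t <= T -> enorm (x k t - x k 0) < rho.
Proof.
move=> B0 Bv delta0 drho slow.
have v0 : 0 < v by apply: le_lt_trans Bv; rewrite mulr_ge0.
set p := x k 0; have p1 : enorm p = 1 by exact: (x_sol k (lexx 0)).1.
pose u t := dotv (x k t) p.
have gapE t : 0 <= t -> enorm (x k t - p) ^+ 2 = 2 - 2 * u t.
  by move=> t0; rewrite sqr_enormB_unit //; exact: (x_sol k t0).1.
pose g s := 2 - 2 * u s - (delta + v * s) ^+ 2.
have rt t : 0 <= t <= T -> 0 < delta + v * t < rho.
  by case/andP => t0 tT; apply/andP; split; nra.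
suff g_gt0 t : 0 <= t <= T -> 0 < (- g) t.
  move=> t tT; have := g_gt0 _ tT; have /andP[r0 r1] := rt _ tT; case/andP: tT => t0 _.
  rewrite /g fctE -gapE // oppr_gt0 subr_lt0 ltr_sqr ?nnegrE ?enorm_ge0 ?(ltW r0) //.
  by move=> /lt_trans; apply.
move: t; apply: pos_of_upcrossing.
- move=> t; apply: (@cvgN _ _ _ (nbhs t)); move: t.
  by apply: continuous_gap; exact: within_continuous_dotv.
- rewrite /g fctE -gapE // mulr0 addr0 sqr_enorm dotvBl subrr.
  by rewrite sub0r opprK exprn_gt0.
- move=> t /andP[t0 tT]; rewrite fctE => gt0.
  have t00 := ltW t0.
  have tI : 0 <= t <= T by rewrite t00.
  have /andP[r0 r1] := rt _ tI.
  have xk1 := (x_sol k t00).1.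
  have dist_k : enorm (x k t - p) = delta + v * t.
    apply/eqP; rewrite -(@eqrXn2 _ 2) ?enorm_ge0 ?(ltW r0) // gapE //.
    by apply/eqP; move: gt0; rewrite /g; lra.
  eexists; last first.
    by apply: is_deriveN; apply: is_derive_gap; exact: is_derive_dotv (x_sol k t00).2 t0.
  (* Testing against [- p] measures the motion away from [p]. *)
  suff : dotv (causal_field beta (fun j => x j t) k) (- p) < v * (delta + v * t).
    by rewrite dotvNr; lra.
  apply: (@le_lt_trans _ _ (k%:R * (B * (delta + v * t)))); last first.
    by rewrite mulrA ltr_pM2r.
  apply: dotv_causal_field_le => //; first by rewrite mulr_ge0 // ltW.
  move=> j jk; have xj1 := (x_sol j t00).1.
  have close : enorm (x k t - p) < rho by rewrite dist_k.
  apply: le_trans (ler_wpM2r (ltW r0) (slow _ tI close _ jk)).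
  rewrite -mulrA ler_pM2l ?expR_gt0 // -dist_k.
  apply: le_trans (gram_unit2_le xk1 xj1 p1); rewrite -normrN.
  by apply: le_trans (ler_norm _); rewrite !dotvNr; lra.
Qed.

End Barriers.

(* MathComp-Analysis. The index s j : 'I_n is 0-based, so its rank is (s j).+1. *)
Theorem lemma2 (R : realType) (beta : R) (beta_gt0 : 0 < beta)
    (n : nat) (n_ge1 : (1 <= n)%N)
    (x : 'I_n -> R -> 'cV[R]_2)
    (x_sol : causal_attention_solution beta x)
    (eps c : R) (eps_gt0 : 0 < eps) (c_gt0 : 0 < c)
    (m : nat) (s : 'I_m -> 'I_n)
    (s_incr : forall i j : 'I_m, (i < j)%N -> (s i < s j)%N)
    (s_center : forall j : 'I_m,
       strong_renyi_center beta c eps (fun i => x i 0) (s j))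
    (c_large : Num.sqrt beta *
         acos ((- 1 + Num.sqrt (4 * beta ^+ 2 + 1)) / (2 * beta)) < c) :
  forall (j : 'I_m) (T : R), 0 <= T ->
    T * (s j).+1%:R * h beta (c * (Num.sqrt beta)^-1)
      < eps * c * (Num.sqrt beta)^-1 ->
    exists M : R,
      is_max [set enorm (x (s j) t - x (s j) 0) | t in `[0, T]] M /\
      M < eps * c * (Num.sqrt beta)^-1.
Proof.
move=> j T T0; set k := s j; set a := c * (Num.sqrt beta)^-1 => hT.
have sb0 : 0 < Num.sqrt beta by rewrite sqrtr_gt0.
have a0 : 0 < a by rewrite divr_gt0.
have thr : acos ((- 1 + Num.sqrt (4 * beta ^+ 2 + 1)) / (2 * beta)) < a.
  by rewrite ltr_pdivlMr // mulrC.
set rho := eps * c * (Num.sqrt beta)^-1; have rhoE : rho = eps * a by rewrite /rho -mulrA.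
have rho0 : 0 < rho by rewrite rhoE mulr_gt0.
set p := x k 0; have p1 : enorm p = 1 by exact: (x_sol k 0 (lexx 0)).1.
suff stay t : 0 <= t <= T -> enorm (x k t - p) < rho.
  (* The distance to [p] is maximal where the inner product with [p] is minimal. *)
  have [t0 t0T umin] := EVT_min T0
    (within_continuous_dotv x_sol (k := k) (e := p) (T := T)).
  rewrite in_itv /= in t0T; exists (enorm (x k t0 - p)); split; last exact: stay.
  split; first by exists t0; rewrite //= in_itv.
  move=> _ [t tT <-]; rewrite /= in_itv /= in tT.
  have /andP[t00 _] := t0T; have /andP[tt0 _] := tT.
  rewrite -ler_sqr ?nnegrE ?enorm_ge0 //.
  rewrite !sqr_enormB_unit //; [|exact: (x_sol k _ _).1..].
  by have := umin t; rewrite in_itv tT => /(_ isT); lra.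
have [k0|k0] := posnP k.
  pose v := rho / (2 * (T + 1)).
  have v0 : 0 < v by rewrite divr_gt0 //; lra.
  have vE : v * (T + 1) = rho / 2 by rewrite /v; field; lra.
  move: t; apply: (@center_stays _ _ _ _ x_sol 0 (rho / 4) rho v T k) => //.
  - by rewrite mulr0.
  - by lra.
  - by nra.
  - by move=> t _ _ i; rewrite k0.
have far (i : 'I_n) : (i < k)%N -> (1 + 2 * eps) * a < enorm (x i 0 - p).
  by move=> ik; rewrite enormBC mulrA [_ * c]mulrC; exact: s_center.
(* A predecessor exists, and its chord to [p] exceeds [a] but is at most 2. *)
have a_ltpi : a < pi.
  have i0 : (Ordinal (ltn_trans k0 (ltn_ord k)) < k)%N by [].
  have := far _ i0; set i := Ordinal _.
  have i1 := (x_sol i 0 (lexx 0)).1.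
  have : enorm (x i 0 - p) ^+ 2 <= 2 ^+ 2.
    by rewrite sqr_enormB_unit //; have /andP[] := dotv_unit_itv i1 p1; lra.
  rewrite ler_sqr ?nnegrE ?enorm_ge0 // => d2 d1.
  by apply: lt_le_trans (pi_ge2 R); nra.
have h0 : 0 < h beta a by rewrite mulr_gt0 ?expR_gt0 // sin_gt0_pi // a0 a_ltpi.
(* The rank [k.+1] exceeds the number [k] of predecessors, which makes the speed bound strict. *)
pose v := k.+1%:R * h beta a.
have v0 : 0 < v by rewrite mulr_gt0.
have vT : v * T < rho by rewrite /v mulrC mulrA.
have kv : k%:R * h beta a < v by rewrite ltr_pM2r // ltr_nat.
have ar : a <= (1 + 2 * eps) * a - v * T by lra.
have away := predecessors_stay_away x_sol T0 beta_gt0 a0 (ltW a_ltpi) (ltW thr)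
  p1 v0 (ltW h0) kv ar far.
(* The initial radius is half of the slack [rho - v T]. *)
move: t; apply: (@center_stays _ _ _ _ x_sol (h beta a) ((rho - v * T) / 2) rho v T k) => //.
- exact: ltW.
- by lra.
- by lra.
move=> t tT close i ik; have /andP[t0 tT'] := tT.
apply: (attraction_le_h beta_gt0 (ltW a0) (ltW a_ltpi) (ltW thr)
  (x_sol k t t0).1 (x_sol i t t0).1).
(* Triangle inequality: [|x_i - x_k|] exceeds [(1 + 2 eps) a - v T - eps a], which is more than [a]
   since [v T < eps a]. *)
have := away _ ik _ tT.
have := enorm_triangle2 (x i t - x k t) (x k t - p).
rewrite subrKA (enormBC (x i t)).
have : v * t <= v * T by rewrite ler_pM2l.
rewrite -/p in close; lra.
Qed.
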